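(* Let $R$ be a commutative ring with non-zero identity, let $M$ be a non-zero multiplication $R$-module, and suppose that $R$ has the good unit element property for $\mathrm{Ann}(M)$. Let $N$ be a proper submodule of $M$. Then the following are equivalent: (1) $N$ is a 1-absorbing prime submodule of $M$. (2) $(N:M)$ is a 1-absorbing prime submodule of the $R$-module $R$ (equivalently, a 1-absorbing prime ideal of $R$). (3) There exists a proper ideal $I$ of $R$ such that $\mathrm{Ann}(M)\subseteq I$, $I$ is a 1-absorbing prime ideal of $R$, and $N=IM$.
   Context: All modules are unital. $U(A)$ denotes the set of units of a ring $A$. For a submodule $N$ of $M$, $(N:M)=\{r\in R: rM\subseteq N\}$, and $\mathrm{Ann}(M)=(0:M)$. $M$ is a multiplication module if every submodule of $M$ has the form $JM$ for some ideal $J$ of $R$. For an ideal $I$ of $R$, $R$ has the good unit element property for $I$ if $U(R/I)=\{r+I: r\in U(R)\}$. A proper submodule $N$ of $M$ is 1-absorbing prime if for all non-unit elements $a,b\in R$ and all $m\in M$, $abm\in N$ implies $ab\in(N:M)$ or $m\in N$. A proper ideal $I$ of $R$ is a 1-absorbing prime ideal if for all non-unit elements $a,b,c\in R$, $abc\in I$ implies $ab\in I$ or $c\in I$. *)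

(* Defs.v *)
From HB Require Import structures.
From mathcomp Require Import all_boot all_order all_algebra.
From mathcomp Require Import boolp.

Set Implicit Arguments.
Unset Strict Implicit.
Unset Printing Implicit Defensive.

Import GRing.Theory.
Local Open Scope ring_scope.
Local Open Scope quotient_scope.

(* Submodules of M are the library's (boolean) linear-closed predicates
   [submodClosed M]; ideals of R are the submodules of the regular module R^o.
   Booleanity is no restriction, since [asbool] decides every proposition. *)
Notation ideal R := (submodClosed (R : comNzRingType)^o).

(* Invertibility without a [unitRingType] structure, so that it applies both
   to R and to its quotient rings. *)
Definition is_unit (A : comNzRingType) (x : A) : Prop := exists y, x * y = 1.

Definition proper_submod (R : comNzRingType) (M : lmodType R)
    (N : submodClosed M) : Prop :=
  exists x : M, x \notin N.

Definition zero_submod (R : comNzRingType) (M : lmodType R) : {pred M} :=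
  fun x => x == 0.

Lemma zero_submod_closed (R : comNzRingType) (M : lmodType R) :
  submod_closed (@zero_submod R M).
Proof.
split=> [|a x y]; rewrite !unfold_in ?eqxx //.
by move=> /eqP-> /eqP->; rewrite scaler0 addr0.
Qed.

HB.instance Definition _ (R : comNzRingType) (M : lmodType R) :=
  GRing.isSubmodClosed.Build R M (@zero_submod R M) (@zero_submod_closed R M).

(* The residual (N : M). *)
Definition colon (R : comNzRingType) (M : lmodType R) (N : submodClosed M) :
  {pred R^o} := fun r => `[< forall m : M, (r : R) *: m \in N >].

Lemma colon_closed (R : comNzRingType) (M : lmodType R) (N : submodClosed M) :
  submod_closed (colon N).
Proof.
split=> [|a x y].
  by apply/asboolP => m; rewrite scale0r rpred0.
move=> /asboolP hx /asboolP hy; apply/asboolP => m.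
have -> : (a *: x + y : R) *: m = a *: ((x : R) *: m) + (y : R) *: m.
  by rewrite scalerDl scalerA.
by apply: rpredD => //; apply: rpredZ.
Qed.

HB.instance Definition _ (R : comNzRingType) (M : lmodType R)
    (N : submodClosed M) :=
  GRing.isSubmodClosed.Build R R^o (colon N) (colon_closed N).

Definition Ann (R : comNzRingType) (M : lmodType R) : ideal R :=
  colon (@zero_submod R M).

Definition proper_idealr (R : comNzRingType) (I : ideal R)
    (hI : proper_submod I) :
  {pred R} := fun x => (x : R^o) \in I.

Lemma proper_idealr_closed (R : comNzRingType) (I : ideal R)
    (hI : proper_submod I) :
  idealr_closed (proper_idealr hI).
Proof.
split=> [||a u v hu hv]; rewrite ?unfold_in.
- exact: (rpred0 I).
- case: hI => x; apply: contra => h1.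
  by rewrite -[x]mulr1; apply: (@rpredZ _ _ I x 1).
- by apply: (@rpredD _ I (a * u) v) => //; apply: (@rpredZ _ _ I a u).
Qed.

(* [idealr R] is the library's type of proper ideals, over which the quotient
   ring [{ideal_quot _}] is defined. *)
HB.instance Definition _ (R : comNzRingType) (I : ideal R)
    (hI : proper_submod I) :=
  isIdealr.Build R (proper_idealr hI) (proper_idealr_closed hI).

(* U(R/I) = {r + I : r in U(R)}; the quotient is formed for proper I only, as
   [{ideal_quot _}] is a non-trivial ring. *)
Definition good_unit (R : comNzRingType) (I : ideal R)
    (hI : proper_submod I) : Prop :=
  forall x : {ideal_quot (proper_idealr hI)},
    is_unit x <->
    exists2 r : R, is_unit r & x = \pi_({ideal_quot (proper_idealr hI)}) r.

Lemma Ann_proper (R : comNzRingType) (M : lmodType R) :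
  (exists m : M, m != 0) -> proper_submod (Ann M).
Proof.
move=> [m m0]; exists (1 : R); apply/negP => /asboolP /(_ m).
by rewrite scale1r unfold_in; apply/negP.
Qed.

(* The product I M. *)
Definition ideal_smul (R : comNzRingType) (I : ideal R) (M : lmodType R) :
  {pred M} :=
  fun x => `[< exists2 s : seq (R * M),
      (forall p, p \in s -> (p.1 : R^o) \in I) &
      x = \sum_(p <- s) p.1 *: p.2 >].
Arguments ideal_smul {R} I M _.

Definition multiplication_module (R : comNzRingType) (M : lmodType R) : Prop :=
  forall N : submodClosed M, exists J : ideal R, N =i ideal_smul J M.

Definition one_absorbing_prime_submod (R : comNzRingType) (M : lmodType R)
    (N : submodClosed M) : Prop :=
  proper_submod N /\
  forall (a b : R) (m : M), ~ is_unit a -> ~ is_unit b ->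
    (a * b) *: m \in N -> (a * b \in colon N) \/ (m \in N).

Definition one_absorbing_prime_ideal (R : comNzRingType) (I : ideal R) : Prop :=
  proper_submod I /\
  forall a b c : R, ~ is_unit a -> ~ is_unit b -> ~ is_unit c ->
    a * b * c \in I -> (a * b \in I) \/ (c \in I).

(* Main.v *)
(* The direction (3) => (1) is the substantial one. In a multiplication module
   every x satisfies x = t x for some t that is a finite sum of elements t_i
   with t_i M contained in a cyclic submodule R n_i. If a b x lies in N = I M
   and a b is not in I, write t_i x = s n_i and t_i (a b x) = p n_i with p in I;
   then t_i (a b s - p) annihilates M, so a b t_i s lies in I, hence t_i s does,
   and t_i ^ 2 x = t_i s n_i lies in N. Hence a power of t maps x into N, and
   that power fixes x. *)
Require Import Defs.
From HB Require Import structures.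
From mathcomp Require Import all_boot all_algebra.
From mathcomp Require Import boolp.

Set Implicit Arguments.
Unset Strict Implicit.
Unset Printing Implicit Defensive.

Import GRing.Theory.
Local Open Scope ring_scope.

Definition cyclic_submod (R : comNzRingType) (M : lmodType R) (x : M) :
  {pred M} := fun y => `[< exists r : R, y = r *: x >].

Lemma cyclic_submod_closed (R : comNzRingType) (M : lmodType R) (x : M) :
  submod_closed (cyclic_submod x).
Proof.
split=> [|a y z]; first by apply/asboolP; exists 0; rewrite scale0r.
move=> /asboolP[r ->] /asboolP[s ->]; apply/asboolP; exists (a * r + s).
by rewrite scalerDl scalerA.
Qed.

HB.instance Definition _ (R : comNzRingType) (M : lmodType R) (x : M) :=
  GRing.isSubmodClosed.Build R M (cyclic_submod x) (cyclic_submod_closed x).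

Lemma mem_cyclic_submod (R : comNzRingType) (M : lmodType R) (x : M) :
  x \in cyclic_submod x.
Proof. by apply/asboolP; exists 1; rewrite scale1r. Qed.

Lemma scale_mem_ideal_smul (R : comNzRingType) (M : lmodType R) (I : ideal R)
  (r : R) (m : M) : (r : R^o) \in I -> r *: m \in ideal_smul I M.
Proof.
move=> rI; apply/asboolP; exists [:: (r, m)]; last by rewrite big_seq1.
by move=> p; rewrite inE => /eqP ->.
Qed.

Lemma ideal_smul_ind (R : comNzRingType) (M : lmodType R) (I : ideal R)
    (P : M -> Prop) :
  P 0 -> (forall x y, P x -> P y -> P (x + y)) ->
  (forall (r : R) m, (r : R^o) \in I -> P (r *: m)) ->
  forall x, x \in ideal_smul I M -> P x.
Proof.
move=> P0 PD PZ x /asboolP[s sI ->].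
by rewrite big_seq; apply: big_ind => // p /sI; apply: PZ.
Qed.

(** Write [R x = J M] and expand [x] into terms [j *: n] with [j] in [J]; then write [R n = K M] and
    expand [n] into terms [u *: w] with [u] in [K]. As [j *: w] lies in [R x], it is some [r *: x],
    so each term is [(u * r) *: x], and [u * r] sends [M] into [K M = R n]. The predicate [D]
    carries what is needed about the sum of these multipliers without listing them. *)
Lemma multiplication_module_fix (R : comNzRingType) (M : lmodType R)
    (M_mult : multiplication_module M) (D : R -> Prop) (x : M) :
  D 0 -> (forall t u, D t -> D u -> D (t + u)) ->
  (forall t n, (forall m : M, t *: m \in cyclic_submod n) -> D t) ->
  exists2 t, D t & x = t *: x.
Proof.
move=> D0 DD Dcyc; have [J xJ] := M_mult (cyclic_submod x).
have := mem_cyclic_submod x; rewrite xJ.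
pose P y := exists2 t, D t & y = t *: x.
have P0 : P 0 by exists 0; rewrite ?scale0r.
have PD y z : P y -> P z -> P (y + z).
  move=> [t Dt ->] [u Du ->]; exists (t + u); first exact: DD.
  by rewrite scalerDl.
apply: (ideal_smul_ind P0 PD) => j n jJ.
have [K nK] := M_mult (cyclic_submod n).
have := mem_cyclic_submod n; rewrite nK.
apply: (@ideal_smul_ind _ _ K (fun n => P (j *: n))).
- by rewrite scaler0.
- by move=> y z Py Pz; rewrite scalerDr; apply: PD.
move=> u w uK; have := scale_mem_ideal_smul w jJ.
rewrite -xJ => /asboolP[r jw]; exists (u * r); last first.
  by rewrite -scalerA -jw !scalerA mulrC.
by apply: (Dcyc _ n) => m; rewrite -scalerA nK; apply: scale_mem_ideal_smul.
Qed.

(** In each binomial term either the exponent of [u] is at least [l] or that of [t] is at least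
    [k]. *)
Lemma scale_exprD_mem (R : comNzRingType) (M : lmodType R) (N : submodClosed M)
    (x : M) (t u : R) (k l : nat) :
  t ^+ k *: x \in N -> u ^+ l *: x \in N -> (t + u) ^+ (k + l) *: x \in N.
Proof.
move=> tN uN; rewrite exprDn scaler_suml; apply: rpred_sum => i _.
rewrite -scalerMnl; apply: rpredMn.
have [li | il] := leqP l i.
  by rewrite -(subnK li) exprD mulrA -scalerA rpredZ.
have ki : (k <= k + l - i)%N by rewrite -addnBA ?leq_addr // ltnW.
by rewrite -(subnK ki) exprD mulrAC -scalerA rpredZ.
Qed.

Lemma cyclic_multiplier_sqr_mem (R : comNzRingType) (M : lmodType R)
    (I : ideal R) (N : submodClosed M) (a b t : R) (x n : M) :
  {subset Ann M <= I} -> one_absorbing_prime_ideal I -> N =i ideal_smul I M ->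
  ~ is_unit a -> ~ is_unit b -> (a * b : R^o) \notin I ->
  (a * b) *: x \in N -> (forall m : M, t *: m \in cyclic_submod n) ->
  t ^+ 2 *: x \in N.
Proof.
move=> annI [_ primeI] NI ua ub abI abxN tn.
have [p pI tp] : exists2 p : R, (p : R^o) \in I & t *: ((a * b) *: x) = p *: n.
  (* Induction over [I M]: on a generator [r *: m] with [t *: m = v *: n], the coefficient is
     [p = v * r]. *)
  move: abxN; rewrite NI; move: (_ *: x).
  apply: ideal_smul_ind => [|y z [p pI tp] [q qI tq]|r m rI].
  - by exists 0; rewrite ?rpred0 // scaler0 scale0r.
  - by exists (p + q); [exact: (rpredD pI qI) | rewrite scalerDr scalerDl tp tq].
  - have /asboolP[v tm] := tn m; exists (v * r); first exact: (@rpredZ _ _ I v).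
    by rewrite scalerA (mulrC t) -(scalerA r) tm scalerA mulrC.
have /asboolP[s ts] := tn x.
have annn : (a * b * s - p) *: n = 0.
  by rewrite scalerBl -tp -(scalerA (a * b)) -ts !scalerA (mulrC t) subrr.
have absI : (a * b * (t * s) : R^o) \in I.
  (* [t] sends [M] into [R n], and [a * b * s - p] kills [n]. *)
  have ann : (t * (a * b * s - p) : R^o) \in I.
    apply: annI; apply/asboolP => m; rewrite mulrC -scalerA.
    have /asboolP[r ->] := tn m.
    by rewrite scalerA mulrC -scalerA annn scaler0 unfold_in.
  have tpI : (t * p : R^o) \in I by apply: (@rpredZ _ _ I t).
  have := rpredD ann tpI.
  by rewrite -[X in X \in _ -> _]/(t * _ + t * p) -mulrDr subrK mulrCA.
have tsI : (t * s : R^o) \in I.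
  (* The absorbing property only speaks of non-units; were [t * s] a unit, cancelling it would put
     [a * b] in [I]. *)
  have [[v tsv] | uts] := pselect (is_unit (t * s)).
    case/negP: abI; have := @rpredZ _ _ I v _ absI.
    by rewrite -[X in X \in _ -> _]/(v * _) mulrCA (mulrC v) tsv mulr1.
  by case: (primeI a b (t * s) ua ub uts absI) => // abI'; case/negP: abI.
by rewrite expr2 -scalerA ts scalerA NI; apply: scale_mem_ideal_smul.
Qed.

Lemma one_absorbing_prime_ideal_smul (R : comNzRingType) (M : lmodType R)
    (I : ideal R) (N : submodClosed M) :
  multiplication_module M -> proper_submod N -> {subset Ann M <= I} ->
  one_absorbing_prime_ideal I -> N =i ideal_smul I M ->
  one_absorbing_prime_submod N.
Proof.
move=> M_mult N_proper annI primeI NI; split=> // a b x ua ub abxN.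
have [abI | abI] := boolP ((a * b : R^o) \in I).
  by left; apply/asboolP => m; rewrite NI; apply: scale_mem_ideal_smul.
right.
have [|t u [k tN] [l uN]|t n tn|t [k tN] xt] :=
  @multiplication_module_fix _ _ M_mult (fun t => exists k, t ^+ k *: x \in N) x.
(* The exponent [0] would not do here, since [0 ^+ 0] is [1]. *)
- by exists 1%N; rewrite expr1 scale0r rpred0.
- by exists (k + l)%N; apply: scale_exprD_mem.
- exists 2%N.
  exact: (cyclic_multiplier_sqr_mem annI primeI NI ua ub abI abxN tn).
suff -> : x = t ^+ k *: x by [].
by elim: k {tN} => [|k IHk]; rewrite ?scale1r // exprSr -scalerA -xt.
Qed.

(** Evaluating at [1] gives one inclusion. This links the submodule and ideal forms of the absorbing
    condition over [R]. *)
Lemma mem_colon_regular (R : comNzRingType) (I : ideal R) : colon I =i I.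
Proof.
move=> r; apply/asboolP/idP => [/(_ 1) | rI m].
  by rewrite -[X in X \in _ -> _]/(r * 1) mulr1.
by rewrite -[X in X \in _]/(r * m) mulrC; apply: (@rpredZ _ _ I m).
Qed.

Lemma colon_proper (R : comNzRingType) (M : lmodType R) (N : submodClosed M) :
  proper_submod N -> proper_submod (colon N).
Proof.
by move=> [x xN]; exists 1; apply: contra xN => /asboolP/(_ x); rewrite scale1r.
Qed.

Lemma Ann_sub_colon (R : comNzRingType) (M : lmodType R) (N : submodClosed M) :
  {subset Ann M <= colon N}.
Proof.
move=> r /asboolP rM; apply/asboolP => m.
by have := rM m; rewrite unfold_in => /eqP ->; apply: rpred0.
Qed.

(** If [N = J M], then [J] is contained in [(N : M)], so [N = J M] lies in [(N : M) M], which always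
    lies in [N]. *)
Lemma multiplication_module_colon (R : comNzRingType) (M : lmodType R)
    (N : submodClosed M) :
  multiplication_module M -> N =i ideal_smul (colon N) M.
Proof.
move=> M_mult x; have [J NJ] := M_mult N.
apply/idP/idP; last first.
  apply: (@ideal_smul_ind _ _ _ (fun y => y \in N)) => [|y z|r m /asboolP //].
    exact: rpred0.
  exact: rpredD.
rewrite NJ => /asboolP[s sJ ->]; apply/asboolP; exists s => // p /sJ pJ.
by apply/asboolP => m; rewrite NJ; apply: scale_mem_ideal_smul.
Qed.

Theorem theorem6 (R : comNzRingType) (M : lmodType R)
    (M_neq0 : exists m : M, m != 0)
    (M_mult : multiplication_module M)
    (R_good : good_unit (Ann_proper M_neq0))
    (N : submodClosed M) (N_proper : proper_submod N) :
  [<-> one_absorbing_prime_submod N;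
       one_absorbing_prime_submod (M := R^o) (colon N);
       one_absorbing_prime_ideal (colon N);
       exists I : ideal R,
         [/\ proper_submod I, {subset Ann M <= I}, one_absorbing_prime_ideal I
           & N =i ideal_smul I M]].
Proof.
have colonN_proper := colon_proper N_proper.
tfae.
- move=> [_ primeN]; split=> // a b c ua ub /asboolP abcN.
  rewrite mem_colon_regular.
  have [abN | abN] := pselect ((a * b : R^o) \in colon N); [by left | right].
  (* The hypothesis on [N] is applied to each vector [c *: m]: since [a * b] is outside [(N : M)],
     all of [c M] falls in [N]. *)
  apply/asboolP => m; case: (primeN a b (c *: m) ua ub) => //.
  by rewrite scalerA; apply: abcN.
- move=> [_ primeN]; split=> // a b c ua ub _ abcN.
  by rewrite -(mem_colon_regular (colon N) (a * b)); apply: primeN.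
- move=> primeN; exists (colon N : ideal R); split=> //; first exact: Ann_sub_colon.
  exact: (multiplication_module_colon N M_mult).
- by move=> [I [_ annI primeI NI]]; apply: (one_absorbing_prime_ideal_smul (I := I)).
Qed.
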